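(* Let $r\geq 1$ and consider the Lie algebra of type $A_r$. Let $\ell$ and $m_1,\dots,m_r$ be nonnegative integers with $\ell-\sum_{i=1}^r i\,m_i=0$, and set $\lambda=\ell\varpi_1$, $\mu=\sum_{i=1}^r m_i\varpi_i$. \begin{enumerate} \item If $m_j=0$ for all $3\le j\le r$, then $m_q(\lambda,\mu)=q^{m_2}$. \item If $m_j=0$ for all $4\le j\le r$ and $m_3\ne 0$, then $m_q(\lambda,\mu)=q^{m_2+3m_3}$. \item If $m_j=0$ for all $5\le j\le r$ and $m_4\neq 0$, then $m_q(\lambda,\mu)=q^{m_2+3m_3+6}$ when $m_4=1$, and $m_q(\lambda,\mu)=q^{m_2+3m_3+6m_4}$ when $m_4\ge 2$. \end{enumerate}
   Context: Type $A_r$: simple roots $\alpha_1,\dots,\alpha_r$; positive roots $\alpha_i+\cdots+\alpha_j$ ($1\le i\le j\le r$); fundamental weights $\varpi_i=\frac{r+1-i}{r+1}(\alpha_1+2\alpha_2+\cdots+(i-1)\alpha_{i-1})+\frac{i}{r+1}((r-i+1)\alpha_i+(r-i)\alpha_{i+1}+\cdots+\alpha_r)$; $\rho=\varpi_1+\cdots+\varpi_r$. $W$ is the Weyl group generated by simple reflections $s_1,\dots,s_r$, and $\mathrm{len}(\sigma)$ is the length of $\sigma\in W$. For a weight $\xi$, the $q$-analog of Kostant's partition function is $\wp_q(\xi)=\sum_{j\ge0}c_jq^j$, where $c_j$ is the number of ways to write $\xi$ as a nonnegative integral sum of exactly $j$ positive roots (counted with multiplicity). The $q$-multiplicity is $m_q(\lambda,\mu)=\sum_{\sigma\in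 W}(-1)^{\mathrm{len}(\sigma)}\wp_q(\sigma(\lambda+\rho)-(\mu+\rho))$. *)

(* Defs.v *)
From HB Require Import structures.
From mathcomp Require Import all_boot all_order all_algebra.
From mathcomp Require Import mathcomp_extra boolp classical_sets fsbigop.

Set Implicit Arguments.
Unset Strict Implicit.
Unset Printing Implicit Defensive.

Import Order.TTheory GRing.Theory Num.Theory.
Local Open Scope ring_scope.

(* Weights are column vectors of coordinates in the basis of simple roots.
   Indices are 0-based: i : 'I_r stands for the mathematical index i + 1, so
   [alpha i] is alpha_(i+1), [fund_weight i] is varpi_(i+1), etc. *)
Definition weight (r : nat) := 'cV[rat]_r.

Definition alpha (r : nat) (i : 'I_r) : weight r := delta_mx i 0.

(* The pair (i, j) with i <= j indexes alpha_i + ... + alpha_j. *)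
Definition pos_root (r : nat) := {p : 'I_r * 'I_r | (p.1 <= p.2)%N}.

Definition root_weight (r : nat) (b : pos_root r) : weight r :=
  \sum_(k < r | ((val b).1 <= k <= (val b).2)%N) alpha k.

Definition fund_weight (r : nat) (i : 'I_r) : weight r :=
  ((r - i)%:R / r.+1%:R) *: (\sum_(j < r | (j < i)%N) j.+1%:R *: alpha j)
  + (i.+1%:R / r.+1%:R) *: (\sum_(j < r | (i <= j)%N) (r - j)%:R *: alpha j).

Definition rho (r : nat) : weight r := \sum_(i < r) fund_weight i.

Definition cartan (r : nat) (i j : 'I_r) : rat :=
  if i == j then 2 else if (i.+1 == j) || (j.+1 == i) then -1 else 0.

(* Matrix, acting on the left, of the linear map
   alpha_j |-> alpha_j - cartan i j *: alpha_i. *)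
Definition simple_refl (r : nat) (i : 'I_r) : 'M[rat]_r :=
  \matrix_(k, j) ((k == j)%:R - (k == i)%:R * cartan i j).

Definition word_mx (r : nat) (w : seq 'I_r) : 'M[rat]_r :=
  \big[mulmx/1%:M]_(i <- w) simple_refl i.

(* Simple reflections are involutions, so the group they generate consists of
   the products of words in them. *)
Definition weyl (r : nat) : set 'M[rat]_r := range (@word_mx r).

Definition has_word (r : nat) (s : 'M[rat]_r) (n : nat) : bool :=
  [exists w : n.-tuple 'I_r, word_mx w == s].

(* Least size of a word for s; the value 0 outside the Weyl group is junk. *)
Definition len (r : nat) (s : 'M[rat]_r) : nat :=
  if pselect (exists n, has_word s n) is left h then ex_minn h else 0%N.

(* Ways to write xi as a sum of exactly n positive roots: f b is the
   multiplicity of b, which is at most n. *)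
Definition npartitions (r : nat) (xi : weight r) (n : nat) : nat :=
  #|[pred f : {ffun pos_root r -> 'I_n.+1} |
      ((\sum_b (f b : nat))%N == n)
      && (\sum_b root_weight b *+ (f b : nat) == xi)]|.

(* The sums over (_ \in _) below are finitely supported sums: npartitions xi n
   vanishes when n exceeds the sum of the coordinates of xi, and the Weyl group
   is finite. *)
Definition kostant_q (r : nat) (xi : weight r) : {poly int} :=
  \sum_(n \in @setT nat) ((npartitions xi n)%:Z *: 'X^n : {poly int}).

Definition mult_q (r : nat) (lambda mu : weight r) : {poly int} :=
  \sum_(s \in @weyl r)
    (-1) ^+ len s * kostant_q (s *m (lambda + rho r) - (mu + rho r)).

(* 1-based access to the family m_1, ..., m_r, extended by m_k = 0 for k > r;
   the extension matters only for m_2 when r = 1. *)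
Definition entry (r : nat) (m : 'I_r -> nat) (k : nat) : nat :=
  (\sum_(i < r | i.+1 == k) m i)%N.

(* Main.v *)
Require Import Defs.
From HB Require Import structures.
From mathcomp Require Import all_boot all_order all_algebra all_fingroup.
From mathcomp Require Import boolp classical_sets fsbigop.
From mathcomp Require Import ssrcomplements mpoly zify ring.

(** Write N = r + 1 and pass to the coordinates e_1, ..., e_N, so that W becomes
    S_N. For lambda = l varpi_1 the numerator sum_s sgn(s) x^(s(lambda + rho))
    is the Weyl denominator times h_l(x), hence
      m_q(lambda, mu) = (prod_(i < j) (1 - R_ij) / (1 - q R_ij)) H (mu),
    where R_ij shifts the argument by e_i - e_j and H is the indicator of the
    vectors with nonnegative entries. Apply the operators for the pairs (i, j)
    with j increasing and, for fixed j, with i increasing. On nonnegative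
    vectors every intermediate function is q^(sum_k w_k mu_k) with w_i = w_j
    just before (i, j) is treated; the series of (1 - R_ij) / (1 - q R_ij) then
    telescopes, and w_j increases by 1. In the end w_j = j - 1, which gives
    m_q(lambda, mu) = q^(sum_i m_i binom(i, 2)) for all m_1, ..., m_r. *)

Set Implicit Arguments.
Unset Strict Implicit.
Unset Printing Implicit Defensive.

Import Order.TTheory GRing.Theory Num.Theory.
Local Open Scope ring_scope.

(** * Polynomials in shift operators *)

Section ShiftEval.
Variables (A : comNzRingType) (n : nat) (V : zmodType) (a : 'I_n -> V).
Implicit Types (f : V -> A) (v : V) (p : {mpoly A[n]}).

Definition mnm_comb (m : 'X_{1..n}) : V := \sum_k a k *+ m k.

Lemma mnm_comb0 : mnm_comb 0%MM = 0.
Proof. by rewrite /mnm_comb big1 // => k _; rewrite mnm0E. Qed.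

Lemma mnm_combD m1 m2 : mnm_comb (m1 + m2)%MM = mnm_comb m1 + mnm_comb m2.
Proof.
by rewrite -big_split /=; apply: eq_bigr => k _; rewrite mnmDE mulrnDr.
Qed.

Lemma mnm_combMn m k : mnm_comb (m *+ k)%MM = mnm_comb m *+ k.
Proof.
by rewrite /mnm_comb -sumrMnl; apply: eq_bigr => j _; rewrite mulmnE mulrnA.
Qed.

Lemma mnm_comb_sum I (s : seq I) P F :
  mnm_comb (\sum_(i <- s | P i) F i)%MM = \sum_(i <- s | P i) mnm_comb (F i).
Proof. exact: (big_morph mnm_comb mnm_combD mnm_comb0). Qed.

(* The value at v of p applied to f, the variable 'X_k acting on functions on V
   as the shift by a k. *)
Definition shift_eval f v p : A :=
  \sum_(m <- msupp p) p@_m * f (v + mnm_comb m).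

Lemma shift_eval_widen f v p d : (msize p <= d)%N ->
  shift_eval f v p = \sum_(m : 'X_{1..n < d}) p@_m * f (v + mnm_comb m).
Proof.
move=> le_pd; rewrite /shift_eval (big_mksub 'X_{1..n < d}) ?msupp_uniq //=.
  by rewrite big_rmcond //= => m /memN_msupp_eq0 ->; rewrite mul0r.
by move=> m /msize_mdeg_lt /leq_trans; apply.
Qed.

Lemma shift_eval_is_linear f v : linear_for *%R (shift_eval f v).
Proof.
move=> c p q /=; pose d := maxn (msize (c *: p + q)) (maxn (msize p) (msize q)).
rewrite !(@shift_eval_widen _ _ _ d) /d ?leq_max ?leqnn ?orbT //.
rewrite big_distrr -big_split /=; apply: eq_bigr => m _.
by rewrite mcoeffD mcoeffZ mulrDl mulrA.
Qed.

HB.instance Definition _ f v :=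
  GRing.isLinear.Build A {mpoly A[n]} A *%R (shift_eval f v)
    (shift_eval_is_linear f v).

Lemma eq_shift_eval f g u v p :
    (forall m, f (u + mnm_comb m) = g (v + mnm_comb m)) ->
  shift_eval f u p = shift_eval g v p.
Proof. by move=> fg; apply: eq_bigr => m _; rewrite fg. Qed.

Lemma shift_evalX f v m : shift_eval f v 'X_[m] = f (v + mnm_comb m).
Proof. by rewrite /shift_eval msuppX big_seq1 mcoeffX eqxx mul1r. Qed.

Lemma shift_eval1 f v : shift_eval f v 1 = f v.
Proof. by rewrite -mpolyX0 shift_evalX mnm_comb0 addr0. Qed.

Lemma shift_evalXM f v m p :
  shift_eval f v ('X_[m] * p) = shift_eval f (v + mnm_comb m) p.
Proof.
rewrite [p]mpolyE mulr_sumr !raddf_sum /=; apply: eq_bigr => m' _.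
by rewrite -scalerAr -mpolyXD !linearZ_LR /= !shift_evalX mnm_combD addrA.
Qed.

Lemma shift_evalM f v p q :
  shift_eval f v (p * q) = shift_eval (fun u => shift_eval f u q) v p.
Proof.
rewrite {1}[p]mpolyE mulr_suml raddf_sum /=; apply: eq_bigr => m _.
by rewrite -scalerAl linearZ_LR /= shift_evalXM.
Qed.

End ShiftEval.

Section TruncatedRatio.
Variables (A : comNzRingType) (q : A) (M : nat).

(* For R = 'X_[m], the series (1 - R) / (1 - q R) with the geometric part cut
   off at degree M. *)
Definition truncated_ratio n (m : 'X_{1..n}) : {mpoly A[n]} :=
  (1 - 'X_[m]) * \sum_(k < M) q ^+ k *: 'X_[m *+ k].

Definition ratio_op (V : zmodType) (b : V) (f : V -> A) (v : V) : A :=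
  \sum_(k < M) q ^+ k * (f (v + b *+ k) - f (v + b *+ k.+1)).

Lemma shift_eval_truncated_ratio n (V : zmodType) (a : 'I_n -> V) f v m :
  shift_eval a f v (truncated_ratio m) = ratio_op (mnm_comb a m) f v.
Proof.
rewrite /truncated_ratio mulr_sumr raddf_sum /=; apply: eq_bigr => k _.
rewrite -scalerAr linearZ_LR /= mulrBl mul1r -mpolyXD raddfB /= !shift_evalX.
by rewrite mnm_combD !mnm_combMn mulrS.
Qed.

Lemma sum_geometric_step (u : nat -> A) x c : (c < M)%N ->
    (forall k, u k = if (k <= c)%N then x else 0) ->
  \sum_(k < M) q ^+ k * (u k - u k.+1) = q ^+ c * x.
Proof.
move=> lt_cM uE; rewrite (bigD1 (Ordinal lt_cM)) //= big1 ?addr0.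
  by rewrite !uE leqnn ltnn subr0.
by move=> k; rewrite -val_eqE /= !uE; case: ltngtP; rewrite ?subrr ?mulr0.
Qed.

End TruncatedRatio.

(** * Integer vectors *)

Section IntegerVectors.
Variable n : nat.
Implicit Types v : 'cV[int]_n.

Definition evec (i : nat) : 'cV[int]_n := \col_j (j == i :> nat)%:R.

Definition coord_sum v : int := \sum_j v j 0.

Lemma coord_sum_is_zmod_morphism : zmod_morphism coord_sum.
Proof. by move=> u v; rewrite -sumrB; apply: eq_bigr => j _; rewrite !mxE. Qed.

HB.instance Definition _ :=
  GRing.isZmodMorphism.Build 'cV[int]_n int coord_sum
    coord_sum_is_zmod_morphism.

Lemma coord_sum_evec i : (i < n)%N -> coord_sum (evec i) = 1.
Proof.
move=> lt_in; rewrite /coord_sum (bigD1 (Ordinal lt_in)) //= mxE eqxx big1 //.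
by move=> j /negPf; rewrite mxE -val_eqE /= => ->.
Qed.

Lemma coord_sum_row_perm (s : 'S_n) v : coord_sum (row_perm s v) = coord_sum v.
Proof.
rewrite /coord_sum [RHS](reindex_inj (@perm_inj _ s)).
by apply: eq_bigr => j _; rewrite mxE.
Qed.

Lemma sum_evecE (c : 'I_n -> nat) j :
  (\sum_(i < n) evec i *+ c i) j 0 = (c j)%:Z.
Proof.
rewrite summxE (bigD1 j) //= mulmxnE mxE eqxx natz big1 ?addr0 ?natz // => i.
by rewrite mulmxnE mxE -val_eqE eq_sym => /negPf ->; rewrite mul0rn.
Qed.

Lemma evec_shiftE v i j k l :
  (v + (evec i - evec j) *+ k) l 0 =
  v l 0 + ((l == i :> nat)%:R - (l == j :> nat)%:R) *+ k.
Proof. by rewrite mxE [X in _ + X]mulmxnE !mxE. Qed.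

Lemma coord_sum_evec_shift v (i j : 'I_n) k :
  coord_sum (v + (evec i - evec j) *+ k) = coord_sum v.
Proof.
by rewrite raddfD raddfMn raddfB /= !coord_sum_evec // subrr mul0rn addr0.
Qed.

Definition nneg_vec v := [forall i, 0 <= v i 0].

Lemma le_coord_sum v j : nneg_vec v -> v j 0 <= coord_sum v.
Proof.
by move=> /forallP v_ge0; rewrite /coord_sum (bigD1 j) //= lerDl sumr_ge0.
Qed.

Lemma nneg_evec_shift v (i j : 'I_n) k : nneg_vec v -> k%:Z <= v j 0 ->
  nneg_vec (v + (evec i - evec j) *+ k).
Proof.
move=> /forallP v_ge0 le_k; apply/forallP => l; rewrite evec_shiftE !val_eqE.
rewrite mulrnBl addrCA addr_ge0 ?mulrn_wge0 ?ler0n //.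
by have [->|_] := eqVneq l j; rewrite ?mul0rn ?subr0 ?natz ?subr_ge0.
Qed.

End IntegerVectors.

Arguments evec {n} i.

Section FundamentalVectors.
Variable r : nat.

Definition fund_vec (i : nat) : 'cV[int]_r.+1 := \col_j (j <= i)%:R.

Lemma tail_sum_fund_vec i k : (i <= r)%N ->
  \sum_(j < r.+1 | (k <= j)%N) fund_vec i j 0 = (i.+1 - k)%N%:Z.
Proof.
move=> le_ir; rewrite -[(i.+1 - k)%N]muln1 -sum_nat_const_nat.
rewrite (big_nat_widenl _ 0%N) // (big_nat_widen _ _ r.+1) // big_mkord.
rewrite -[RHS]natz natr_sum big_mkcond [RHS]big_mkcond.
apply: eq_bigr => j _; rewrite mxE ltnS.
by case: (k <= j)%N; case: (j <= i)%N.
Qed.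

Lemma coord_sum_fund_vec i : (i <= r)%N -> coord_sum (fund_vec i) = i.+1%:Z.
Proof. by move=> le_ir; rewrite -[RHS](tail_sum_fund_vec 0 le_ir). Qed.

Lemma sum_fund_vecE (m : 'I_r -> nat) j :
  (\sum_(i < r) fund_vec i *+ m i) j 0 = (\sum_(i < r | (j <= i)%N) m i)%N%:Z.
Proof.
rewrite summxE -natz natr_sum [RHS]big_mkcond; apply: eq_bigr => i _.
by rewrite mulmxnE mxE; case: leqP; rewrite ?mul0rn.
Qed.

Lemma coord_sum_sum_fund_vec (m : 'I_r -> nat) :
  coord_sum (\sum_(i < r) fund_vec i *+ m i) = (\sum_(i < r) i.+1 * m i)%N%:Z.
Proof.
rewrite -[RHS]natz natr_sum raddf_sum; apply: eq_bigr => i _.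
by rewrite raddfMn /= coord_sum_fund_vec 1?ltnW // natrM mulr_natr natz.
Qed.

Definition rho_vec : 'cV[int]_r.+1 := \sum_(i < r) fund_vec i.

Lemma rho_vecE j : rho_vec j 0 = r%:Z - j%:Z.
Proof.
have le_jr : (j <= r)%N by rewrite -ltnS.
rewrite (sum_fund_vecE (fun=> 1%N)) -(big_mkord (leq j) (fun=> 1%N)).
rewrite -(@big_nat_widenl _ _ _ j 0 r xpredT) // sum_nat_const_nat muln1.
by rewrite subzn.
Qed.

End FundamentalVectors.

(** * The Weyl denominator *)

Lemma vandermonde_sum (R : comNzRingType) n (x : 'I_n -> R) :
  \sum_(s : 'S_n) (-1) ^+ s * \prod_i x i ^+ s i =
  \prod_(i < n) \prod_(j < n | (i < j)%N) (x j - x i).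
Proof.
transitivity (\det (Vandermonde n (\row_i x i))); last first.
  by rewrite det_Vandermonde; do 2!apply: eq_bigr => ? _; rewrite !mxE.
rewrite -det_tr; apply: eq_bigr => s _; congr (_ * _).
by apply: eq_bigr => i _; rewrite !mxE.
Qed.

Lemma prod_ltn_pairs (R : comNzRingType) n (F : nat -> nat -> R) :
  \prod_(i < n) \prod_(j < n | (i < j)%N) F i j =
  \prod_(j < n) \prod_(i < j) F i j.
Proof.
rewrite (exchange_big_dep predT) //=; apply: eq_bigr => j _.
by rewrite (big_ord_widen n (fun i => F i j)) 1?ltnW.
Qed.

Section Denominator.
Variable r : nat.
Implicit Types i j : nat.

Definition simple_vec (k : 'I_r) : 'cV[int]_r.+1 := evec k - evec k.+1.

(* The exponents of e_i - e_j in terms of simple roots, for [i <= j <= r]. *)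
Definition root_mnm i j : 'X_{1..r} :=
  [multinom ((i <= k < j)%N : nat) | k < r].

Lemma mnm_comb_root i j : (i <= j <= r)%N ->
  mnm_comb simple_vec (root_mnm i j) = evec i - evec j.
Proof.
case/andP=> le_ij le_jr; rewrite -opprB -(telescope_sumr _ le_ij) -sumrN.
rewrite (big_nat_widenl _ 0%N) // (big_nat_widen _ _ r) // big_mkord.
rewrite [RHS]big_mkcond; apply: eq_bigr => k _.
by rewrite mnmE opprB /= andbC; case: ifP.
Qed.

Definition root_vec (b : pos_root r) : 'cV[int]_r.+1 :=
  evec (val b).1 - evec (val b).2.+1.

Definition pos_root_mnm (b : pos_root r) : 'X_{1..r} :=
  root_mnm (val b).1 (val b).2.+1.

Lemma mnm_comb_pos_root b : mnm_comb simple_vec (pos_root_mnm b) = root_vec b.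
Proof. by rewrite mnm_comb_root ?ltn_ord ?leqW // (valP b). Qed.

Lemma coord_sum_mnm_comb m : coord_sum (mnm_comb simple_vec m) = 0.
Proof.
rewrite raddf_sum big1 // => k _.
have lt_kr := ltn_ord k.
by rewrite raddfMn raddfB /= !coord_sum_evec ?subrr ?mul0rn // ltnW.
Qed.

Lemma root_mnmD i j k : (i <= j <= k)%N ->
  root_mnm i k = (root_mnm i j + root_mnm j k)%MM.
Proof. by move=> le_ijk; apply/mnmP => l; rewrite mnmDE !mnmE; lia. Qed.

Definition weyl_denominator (A : comNzRingType) : {mpoly A[r]} :=
  \prod_(b : pos_root r) (1 - 'X_[pos_root_mnm b]).

Lemma prod_pos_root (R : comNzRingType) (F : nat -> nat -> R) :
  \prod_(b : pos_root r) F (val b).1 (val b).2.+1 =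
  \prod_(j < r) \prod_(i < j.+1) F i j.+1.
Proof.
transitivity (\prod_(p : 'I_r * 'I_r | (p.1 <= p.2)%N) F p.1 p.2.+1).
  rewrite [RHS](reindex_omap (val : pos_root r -> _) insub) /=; last first.
    by move=> p p12; rewrite insubT.
  by apply: eq_bigl => b; rewrite valK eqxx (valP b).
rewrite -(pair_big_dep xpredT (fun i j : 'I_r => (i <= j)%N)
                       (fun i j : 'I_r => F i j.+1)).
rewrite (exchange_big_dep predT) //=; apply: eq_bigr => j _.
by rewrite (big_ord_widen r (fun i => F i j.+1)).
Qed.

Definition perm_mnm (s : 'S_r.+1) : 'X_{1..r} :=
  (\sum_(i < r.+1) root_mnm i r *+ s i)%MM.

(* The left-hand side is a Vandermonde determinant in the e^(e_i - e_r). *)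
Lemma vandermonde_weyl_denominator (A : comNzRingType) :
  \sum_(s : 'S_r.+1) (-1) ^+ s * 'X_[perm_mnm s] =
  'X_[perm_mnm 1] * weyl_denominator A.
Proof.
rewrite /perm_mnm; under eq_bigr do rewrite -mprodXnE.
rewrite (vandermonde_sum (fun i : 'I_r.+1 => 'X_[root_mnm i r])) -mprodXnE.
under [X in X * _]eq_bigr do rewrite perm1.
rewrite (prod_ltn_pairs _ (fun i j => 'X_[root_mnm j r] - 'X_[root_mnm i r])).
rewrite /weyl_denominator (prod_pos_root (fun i j => 1 - 'X_[root_mnm i j])).
rewrite !big_ord_recl /= expr0 big_ord0 !mul1r -big_split.
apply: eq_bigr => j _ /=; rewrite /bump leq0n add1n.
rewrite -[X in _ ^+ X]card_ord -prodr_const -big_split.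
apply: eq_bigr => i _ /=.
rewrite (@root_mnmD i j.+1 r) ?mpolyXD; first by ring.
by have := ltn_ord i; have := ltn_ord j; lia.
Qed.

Definition perm_vec (s : 'S_r.+1) : 'cV[int]_r.+1 := \col_i (s i)%:Z.

Lemma mnm_comb_perm_mnm s :
  mnm_comb simple_vec (perm_mnm s) = perm_vec s - \sum_(i < r.+1) evec r *+ i.
Proof.
have -> : perm_vec s = \sum_(i < r.+1) evec i *+ s i.
  by apply/colP => i; rewrite sum_evecE mxE.
rewrite [X in _ - X](reindex_inj (@perm_inj _ s)) -sumrB mnm_comb_sum.
apply: eq_bigr => i _.
by rewrite mnm_combMn mnm_comb_root ?mulrnBl // leqnn -ltnS ltn_ord.
Qed.

Lemma shift_eval_weyl_denominator (A : comNzRingType)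
    (f : 'cV[int]_r.+1 -> A) v :
  shift_eval simple_vec f (v + perm_vec 1) (weyl_denominator A) =
  \sum_(s : 'S_r.+1) (-1) ^+ s * f (v + perm_vec s).
Proof.
pose u := v + \sum_(i < r.+1) evec r *+ i.
have perm_vecE s : v + perm_vec s = u + mnm_comb simple_vec (perm_mnm s).
  by rewrite mnm_comb_perm_mnm addrACA subrr addr0.
rewrite perm_vecE -shift_evalXM -vandermonde_weyl_denominator raddf_sum.
by apply: eq_bigr => s _; rewrite raddfMsign /= shift_evalX perm_vecE.
Qed.

End Denominator.

Arguments simple_vec {r} k.

(** * Alternants of one-row weights *)

Lemma det_indicator (R : comNzRingType) n (b : 'I_n -> 'I_n -> bool) :
  \det (\matrix_(i, j) (b i j)%:R) =
  \sum_(s : 'S_n) (-1) ^+ s * [forall i, b i (s i)]%:R :> R.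
Proof.
apply: eq_bigr => s _; congr (_ * _).
case: (boolP [forall i, b i (s i)]) => [/forallP b_s|/forallPn[i /negPf b_i]].
  by rewrite big1 // => i _; rewrite mxE b_s.
by rewrite (bigD1 i) //= mxE b_i mul0r.
Qed.

(* Adding to each column the previous ones turns equalities into thresholds. *)
Lemma det_threshold (R : comNzRingType) n (x : 'I_n -> int) (c : int) :
  \det (\matrix_(i, j < n)
    (if j == 0%N :> nat then c <= x i else x i == c - j%:Z)%R%:R) =
  \det (\matrix_(i, j < n) (c - j%:Z <= x i)%R%:R) :> R.
Proof.
pose b i (k : nat) : bool := if k == 0%N then c <= x i else x i == c - k%:Z.
have sum_b i j : \sum_(k < j.+1) (b i k)%:R = (c - j%:Z <= x i)%R%:R :> R.
  elim: j => [|j IHj]; first by rewrite big_ord1 subr0.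
  rewrite big_ord_recr /= IHj -natrD; congr (_%:R); rewrite /b /=; lia.
pose U : 'M[R]_n := \matrix_(k, j) (k <= j)%:R.
have detU : \det U = 1.
  rewrite -det_tr det_trig; first by rewrite big1 // => i _; rewrite !mxE leqnn.
  by apply/is_trig_mxP => i j; rewrite !mxE ltnNge => /negPf ->.
rewrite -[LHS]mulr1 -[X in _ * X]detU -det_mulmx.
congr (\det _); apply/matrixP => i j.
rewrite !mxE -(sum_b i j) (big_ord_widen n (fun k => (b i k)%:R)) //.
rewrite [RHS]big_mkcond.
by apply: eq_bigr => k _; rewrite !mxE ltnS; case: leqP; rewrite ?mulr1 ?mulr0.
Qed.

Section Alternant.
Variable A : comNzRingType.

Definition alternant n (kappa nu : 'cV[int]_n) : A :=
  \sum_(s : 'S_n) (-1) ^+ s * (nu == row_perm s kappa)%:R.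

Definition nneg_indicator n (v : 'cV[int]_n) : A := (nneg_vec v)%:R.

Variable r : nat.
Implicit Types nu : 'cV[int]_r.+1.

Definition row_rho_vec (l : nat) : 'cV[int]_r.+1 :=
  fund_vec r 0 *+ l + rho_vec r.

Lemma row_rho_vecE l j :
  row_rho_vec l j 0 = (if j == 0%N :> nat then l%:Z else 0) + (r%:Z - j%:Z).
Proof.
rewrite mxE rho_vecE mulmxnE mxE leqn0; congr (_ + _).
by case: eqP => _; rewrite ?mul0rn ?natz.
Qed.

(* The value in the row of the largest threshold is forced by the sum. *)
Lemma eq_row_perm_row_rho_vec l nu (s : 'S_r.+1) :
    coord_sum nu = coord_sum (row_rho_vec l) ->
  (nu == row_perm s (row_rho_vec l)) =
  [forall i, if s i == 0%N :> nat then r%:Z <= nu i 0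
             else nu i 0 == r%:Z - (s i : nat)%:Z].
Proof.
rewrite -(coord_sum_row_perm s (row_rho_vec l)) => sum_nu.
apply/eqP/forallP => [-> i|nu_s].
  by rewrite mxE row_rho_vecE; case: eqP => [->|_]; lia.
pose k := (s^-1)%g ord0.
have nu_off_k i : i != k -> nu i 0 = row_perm s (row_rho_vec l) i 0.
  move=> neq_ik; have := nu_s i; rewrite mxE row_rho_vecE.
  case: eqP => [si0|_ /eqP ->]; last by rewrite add0r.
  by case/eqP: neq_ik; apply/(canRL (permK s))/val_inj.
apply/colP => i; have [->|/nu_off_k //] := eqVneq i k.
move: sum_nu; rewrite /coord_sum (bigD1 k) //= [RHS](bigD1 k) //=.
by rewrite (eq_bigr _ nu_off_k) => /addIr.
Qed.

Lemma alternant_row l nu :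
    coord_sum nu = coord_sum (row_rho_vec l) ->
  alternant (row_rho_vec l) nu =
  shift_eval simple_vec (@nneg_indicator r.+1) (nu - rho_vec r)
    (weyl_denominator r A).
Proof.
move=> sum_nu; pose b (i j : 'I_r.+1) : bool :=
  if j == 0%N :> nat then r%:Z <= nu i 0 else nu i 0 == r%:Z - j%:Z.
transitivity (\det (\matrix_(i, j) (b i j)%:R : 'M[A]_r.+1)).
  rewrite det_indicator; apply: eq_bigr => s _.
  by rewrite eq_row_perm_row_rho_vec.
rewrite det_threshold det_indicator.
have -> : nu - rho_vec r = nu - const_mx r%:Z + perm_vec 1.
  by apply/colP => i; rewrite !mxE rho_vecE perm1; lia.
rewrite shift_eval_weyl_denominator; apply: eq_bigr => s _.
congr (_ * (nat_of_bool _)%:R).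
by apply: eq_forallb => i; rewrite !mxE -subr_ge0 opprB addrA addrAC.
Qed.

End Alternant.

Arguments nneg_indicator {A n} v.

(** * Telescoping over the positive roots *)

Section QPower.
Variables (A : comNzRingType) (q : A) (M n : nat).
Implicit Types (w : nat -> nat) (F : 'cV[int]_n -> A) (v : 'cV[int]_n).

Definition wdeg w v : nat := \sum_(l < n) w l * `|v l 0%R|.

Lemma wdeg_evec_shift w v (i j : 'I_n) k : i != j -> w i = w j ->
    nneg_vec v -> nneg_vec (v + (evec i - evec j) *+ k) ->
  wdeg w (v + (evec i - evec j) *+ k) = wdeg w v.
Proof.
move=> neq_ij wij /forallP v_ge0 /forallP vk_ge0.
have neq_ji : j != i by rewrite eq_sym.
rewrite /wdeg (bigD1 i) // (bigD1 j) //= [RHS](bigD1 i) // (bigD1 j) //=.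
rewrite !addnA -wij -!mulnDr; congr (_ * _ + _)%N.
  have := v_ge0 i; have := v_ge0 j; have := vk_ge0 i; have := vk_ge0 j.
  rewrite !evec_shiftE !eqxx !val_eqE (negPf neq_ij) (negPf neq_ji).
  by rewrite subr0 sub0r mulNrn; lia.
apply: eq_bigr => l /andP[li lj].
by rewrite evec_shiftE !val_eqE (negPf li) (negPf lj) subrr mul0rn addr0.
Qed.

Lemma wdeg_add_eq w v (j : 'I_n) :
  wdeg (fun l => w l + (l == j :> nat))%N v = (wdeg w v + `|v j 0%R|)%N.
Proof.
rewrite /wdeg; under eq_bigr do rewrite mulnDl.
rewrite big_split /=; congr (_ + _)%N.
rewrite (@big_only1 _ _ _ _ j) ?eqxx ?mul1n // => l.
by rewrite -val_eqE /= => /negPf ->.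
Qed.

Definition qpower t w F : Prop :=
  (forall v (j : 'I_n), (t < j)%N -> v j 0 < 0 -> F v = 0) /\
  (forall v, nneg_vec v -> coord_sum v < M%:Z -> F v = q ^+ wdeg w v).

Lemma qpower_weaken t t' w w' F : (t <= t')%N ->
    (forall l, (l < n)%N -> w l = w' l) ->
  qpower t w F -> qpower t' w' F.
Proof.
move=> le_tt' eq_w [F_neg F_nneg]; split=> [v j lt_t'j|v v_ge0 v_lt_M].
  exact/F_neg/(leq_ltn_trans le_tt').
by rewrite F_nneg //; congr (_ ^+ _); apply: eq_bigr => l _; rewrite eq_w.
Qed.

Lemma qpower_on_line t w F v (i j : 'I_n) k :
    qpower t w F -> (t < j)%N -> i != j -> w i = w j ->
    nneg_vec v -> coord_sum v < M%:Z ->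
  F (v + (evec i - evec j) *+ k) =
  if (k <= `|v j 0%R|)%N then q ^+ wdeg w v else 0.
Proof.
move=> [F_neg F_nneg] lt_tj neq_ij wij v_ge0 v_lt_M.
have v_j := forallP v_ge0 j; case: ifPn => [le_k|gt_k].
  have vk_ge0 : nneg_vec (v + (evec i - evec j) *+ k).
    by apply: nneg_evec_shift => //; lia.
  by rewrite F_nneg ?coord_sum_evec_shift // wdeg_evec_shift.
apply: (F_neg _ j lt_tj); rewrite evec_shiftE eqxx val_eqE.
by rewrite eq_sym (negPf neq_ij) sub0r mulNrn; lia.
Qed.

Lemma qpower_ratio_op t w F (i j : 'I_n) : (i <= t < j)%N -> w i = w j ->
    qpower t w F ->
  qpower t (fun l => w l + (l == j :> nat))%N
    (ratio_op q M (evec i - evec j) F).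
Proof.
case/andP=> le_it lt_tj wij qp_F; split=> [v l lt_tl v_l|v v_ge0 v_lt_M].
  rewrite /ratio_op big1 // => k _.
  have F0 c : F (v + (evec i - evec j) *+ c) = 0.
    apply: (qp_F.1 _ l lt_tl); rewrite evec_shiftE.
    rewrite (_ : (l == i :> nat) = false); last by lia.
    by rewrite sub0r mulNrn; lia.
  by rewrite !F0 subrr mulr0.
have neq_ij : i != j by rewrite -val_eqE /=; lia.
pose u k := F (v + (evec i - evec j) *+ k).
rewrite [LHS](@sum_geometric_step _ q M u (q ^+ wdeg w v) `|v j 0%R|%N).
- by rewrite -exprD addnC wdeg_add_eq.
- by have := le_coord_sum j v_ge0; have := forallP v_ge0 j; lia.
- by move=> k; apply: qpower_on_line qp_F _ _ _ _ _.
Qed.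

End QPower.

Section RootProduct.
Variables (A : comNzRingType) (q : A) (M r : nat).

Let nneg_shift (p : {mpoly A[r]}) (v : 'cV[int]_r.+1) : A :=
  shift_eval simple_vec nneg_indicator v p.

(* The weights after the roots e_i - e_j with j <= t, and those with j = t + 1
   and i < s, have been processed; coordinates are numbered from 0 to r. *)
Definition partial_weight t s l : nat :=
  if (l <= t)%N then l else if l == t.+1 then s else 0.

Lemma qpower_nneg_shift1 : qpower q M 0 (partial_weight 0 0) (nneg_shift 1).
Proof.
split=> [v j _ v_j|v v_ge0 _]; rewrite /nneg_shift shift_eval1 /nneg_indicator.
  by case: (boolP (nneg_vec v)) => // /forallP/(_ j); rewrite leNgt v_j.
rewrite v_ge0 /wdeg big1 ?expr0 // => l _.
by rewrite /partial_weight if_same leqn0; case: eqP => [->|_].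
Qed.

Lemma qpower_truncated_ratio p t s : (s <= t < r)%N ->
    qpower q M t (partial_weight t s) (nneg_shift p) ->
  qpower q M t (partial_weight t s.+1)
    (nneg_shift (p * truncated_ratio q M (root_mnm r s t.+1))).
Proof.
move=> /andP[le_st lt_tr] qp_p.
have lt_sr : (s < r.+1)%N by lia.
have -> : nneg_shift (p * truncated_ratio q M (root_mnm r s t.+1)) =
    ratio_op q M (evec s - evec t.+1) (nneg_shift p).
  apply/funext => v; rewrite /nneg_shift mulrC shift_evalM.
  by rewrite shift_eval_truncated_ratio mnm_comb_root // ltnW.
pose i : 'I_r.+1 := Ordinal lt_sr.
pose j : 'I_r.+1 := Ordinal (lt_tr : (t.+1 < r.+1)%N).
apply: qpower_weaken (leqnn t) _ (@qpower_ratio_op _ _ _ _ _ _ _ i j _ _ qp_p).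
- by move=> l _; rewrite /partial_weight /=; do !case: ifP; lia.
- by rewrite /= le_st ltnSn.
- by rewrite /partial_weight /= le_st ltnn eqxx.
Qed.

Lemma qpower_root_rows t : (t <= r)%N ->
  qpower q M t (partial_weight t 0)
    (nneg_shift (\prod_(j < t) \prod_(i < j.+1)
                   truncated_ratio q M (root_mnm r i j.+1))).
Proof.
elim: t => [_|t IHt lt_tr].
  by rewrite big_ord0; apply: qpower_nneg_shift1.
rewrite big_ord_recr /=; set p := \prod_(j < t) _.
suff qp_row s : (s <= t.+1)%N -> qpower q M t (partial_weight t s)
    (nneg_shift (p * \prod_(i < s) truncated_ratio q M (root_mnm r i t.+1))).
  apply: qpower_weaken (leqnSn t) _ (qp_row _ (leqnn _)) => l _.
  by rewrite /partial_weight if_same; do !case: ifP; lia.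
elim: s => [_|s IHs lt_st]; first by rewrite big_ord0 mulr1; apply/IHt/ltnW.
rewrite big_ord_recr /= mulrA.
by apply: qpower_truncated_ratio (IHs (ltnW _)); lia.
Qed.

Lemma shift_eval_prod_truncated_ratio v :
    nneg_vec v -> coord_sum v < M%:Z ->
  shift_eval simple_vec nneg_indicator v
    (\prod_(b : pos_root r) truncated_ratio q M (pos_root_mnm b)) =
  q ^+ wdeg id v.
Proof.
move=> v_ge0 v_lt_M.
rewrite (prod_pos_root r (fun i j => truncated_ratio q M (root_mnm r i j))).
have [_ /(_ v)] := qpower_root_rows (leqnn r); rewrite /nneg_shift => -> //.
by congr (_ ^+ _); apply: eq_bigr => l _; rewrite /partial_weight -ltnS ltn_ord.
Qed.

End RootProduct.

(** * Weights in standard coordinates *)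

Section StandardWeights.
Variable r : nat.
Implicit Types v : 'cV[int]_r.+1.

(* The weights of the standard representation: [eps 0] is the first fundamental
   weight, and [eps j - eps j.+1] is the simple root alpha_j. *)
Definition eps (j : nat) : weight r :=
  \col_k ((r%:R - k%:R) / r.+1%:R - (k < j)%N%:R).

Definition weight_of v : weight r := \sum_(j < r.+1) (v j 0)%:~R *: eps j.

Lemma weight_of_is_zmod_morphism : zmod_morphism weight_of.
Proof.
move=> u v; rewrite -sumrB; apply: eq_bigr => j _.
by rewrite !mxE rmorphB scalerBl.
Qed.

HB.instance Definition _ :=
  GRing.isZmodMorphism.Build 'cV[int]_r.+1 (weight r) weight_of
    weight_of_is_zmod_morphism.

Lemma weight_of_evec (j : nat) : (j <= r)%N -> weight_of (evec j) = eps j.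
Proof.
rewrite -ltnS => lt_jr.
rewrite /weight_of (@big_only1 _ _ _ _ (Ordinal lt_jr)) //.
  by rewrite mxE eqxx scale1r.
by move=> i; rewrite -val_eqE mxE /= => /negPf -> _; rewrite scale0r.
Qed.

Lemma weight_ofE v k : weight_of v k 0 =
  (r%:R - k%:R) / r.+1%:R * (coord_sum v)%:~R -
  (\sum_(j < r.+1 | (k < j)%N) v j 0)%:~R.
Proof.
rewrite summxE /coord_sum !rmorph_sum mulr_sumr [X in _ - X]big_mkcond -sumrB.
apply: eq_bigr => j _; rewrite !mxE mulrBr mulrC; congr (_ - _).
by case: ltnP; rewrite ?mulr1 ?mulr0.
Qed.

Lemma weight_of_inj u v :
  coord_sum u = coord_sum v -> weight_of u = weight_of v -> u = v.
Proof.
move=> sum_uv /colP weight_uv; apply/eqP; rewrite -subr_eq0; apply/eqP.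
pose d := u - v; rewrite -/d.
have sum_d : coord_sum d = 0 by rewrite raddfB /= sum_uv subrr.
have tail_d k : \sum_(j < r.+1 | (k <= j)%N) d j 0 = 0.
  case: k => [|k]; first by rewrite -[RHS]sum_d.
  have [lt_kr|le_rk] := ltnP k r; last first.
    by rewrite big1 // => j; have := ltn_ord j; lia.
  have := weight_ofE d (Ordinal lt_kr); rewrite sum_d mulr0 sub0r raddfB /= mxE.
  rewrite [X in _ + X]mxE weight_uv subrr => /eqP.
  by rewrite eq_sym oppr_eq0 intr_eq0 => /eqP.
apply/colP => j; rewrite [RHS]mxE.
have := tail_d j; rewrite (bigD1 j) //=.
rewrite (eq_bigl (fun i : 'I_r.+1 => (j < i)%N)).
  by rewrite (tail_d j.+1) addr0.
by move=> i; rewrite ltn_neqAle andbC eq_sym.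
Qed.

Lemma weight_of_simple_vec k : weight_of (simple_vec k) = alpha k.
Proof.
have lt_kr := ltn_ord k; rewrite raddfB /= !weight_of_evec // 1?ltnW //.
apply/colP => l; rewrite !mxE andbT -val_eqE ltnS /=.
rewrite opprB addrC addrA subrK.
by case: (ltngtP l k) => _; rewrite ?subrr ?subr0.
Qed.

Lemma weight_of_root_vec (b : pos_root r) :
  weight_of (root_vec b) = root_weight b.
Proof.
rewrite -mnm_comb_pos_root raddf_sum [RHS]big_mkcond.
apply: eq_bigr => k _; rewrite raddfMn /= weight_of_simple_vec mnmE ltnS.
by case: ifP.
Qed.

Lemma sum_scale_alphaE (P : pred 'I_r) (c : 'I_r -> rat) k :
  (\sum_(j < r | P j) c j *: alpha j) k 0 = if P k then c k else 0.
Proof.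
rewrite summxE big_mkcond (@big_only1 _ _ _ _ k) // => [|j neq_jk _].
  by rewrite !mxE !eqxx mulr1.
by rewrite !mxE eq_sym (negPf neq_jk) mulr0 if_same.
Qed.

Lemma weight_of_fund_vec (i : 'I_r) : weight_of (fund_vec r i) = fund_weight i.
Proof.
have lt_ir := ltn_ord i; apply/colP => k; have lt_kr := ltn_ord k.
rewrite weight_ofE tail_sum_fund_vec ?coord_sum_fund_vec 1?ltnW // subSS.
rewrite [RHS]mxE [X in _ = X + _]mxE [X in _ = _ + X]mxE !sum_scale_alphaE.
case: ltnP => [lt_ki|le_ik]; rewrite -!pmulrn ?mulr0 ?addr0 ?add0r.
  by rewrite !natrB 1?ltnW //; field; rewrite nat1r pnatr_eq0.
rewrite (eqP (le_ik : i - k == 0)%N) natrB 1?ltnW //.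
by field; rewrite nat1r pnatr_eq0.
Qed.

Lemma weight_of_rho_vec : weight_of (rho_vec r) = rho r.
Proof.
by rewrite raddf_sum; apply: eq_bigr => i _; apply: weight_of_fund_vec.
Qed.

End StandardWeights.

(** * The Weyl group as a symmetric group *)

Section WeylGroup.
Variable r : nat.
Implicit Types (i : 'I_r) (s : 'S_r.+1) (w : seq 'I_r) (v : 'cV[int]_r.+1).

Lemma simple_refl_mulmx i (x : weight r) :
  simple_refl i *m x = x - (\sum_l cartan i l * x l 0) *: alpha i.
Proof.
apply/colP => k; rewrite !mxE andbT; under eq_bigr do rewrite mxE mulrBl -mulrA.
rewrite sumrB -mulr_sumr mulrC (@big_only1 _ _ _ _ k) ?eqxx ?mul1r // => l.
by rewrite eq_sym => /negPf ->; rewrite mul0r.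
Qed.

Lemma sum_cartan i (g : nat -> rat) : g 0%N = 0 -> g r.+1 = 0 ->
  \sum_(l < r) cartan i l * g l.+1 = 2 * g i.+1 - g i - g i.+2.
Proof.
move=> g_0 g_r1.
have cartanE (l : 'I_r) : cartan i l * g l.+1 =
    (if l == i :> nat then 2 * g l.+1 else 0) -
    (if l.+1 == i :> nat then g l.+1 else 0) -
    (if l == i.+1 :> nat then g l.+1 else 0).
  rewrite /cartan [i == l]eq_sym -!val_eqE /= [i.+1 == l]eq_sym.
  by do !case: eqP => //=; try lia; move=> *; ring.
under eq_bigr do rewrite cartanE.
rewrite !sumrB -!big_mkcond (big_ord1_eq _ (fun l => 2 * g l.+1)).
rewrite (big_ord1_eq _ (fun l => g l.+1) i.+1) ltn_ord.
have -> : \sum_(l < r | l.+1 == i :> nat) g l.+1 = g i.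
  case: i {cartanE} => [[|i] lt_ir] /=; first by rewrite big_pred0.
  by rewrite (big_ord1_eq _ (fun l => g l.+1) i) (ltnW lt_ir).
congr (_ - _); case: ltnP => // le_ri.
by rewrite (_ : i.+2 = r.+1) ?g_r1 //; have := ltn_ord i; lia.
Qed.

Lemma sum_cartan_eps i (j : nat) : (j <= r)%N ->
  \sum_l cartan i l * eps r j l 0 = (j == i :> nat)%:R - (j == i.+1 :> nat)%:R.
Proof.
move=> le_jr; pose g t : rat := (r.+1%:R - t%:R) / r.+1%:R - (t <= j)%N%:R.
under eq_bigr => l _.
  rewrite (_ : eps r j l 0 = g l.+1); last first.
    by rewrite mxE /g; congr (_ / _ - _); rewrite -!nat1r; ring.
  over.
rewrite sum_cartan /g; last 2 first.
- by rewrite subr0 divff ?subrr // pnatr_eq0.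
- by rewrite subrr mul0r sub0r ltnNge le_jr oppr0.
have linear_cancel (N t c x y z : rat) :
    2 * ((N - (t + 1)) * c - x) - ((N - t) * c - y) -
    ((N - (t + 1 + 1)) * c - z) = y + z - 2 * x by ring.
rewrite -!natr1 linear_cancel.
have [lt_ij|lt_ji|->] := ltngtP i j; last by rewrite ltnNge leqnSn ltn_eqF.
  by case: (ltngtP i.+1 j) lt_ij => // _ _; ring.
by rewrite ltnNge leqW ?(ltnW lt_ji) // ltn_eqF ?leqW // mulr0 subrr.
Qed.

Definition adj_tperm i : 'S_r.+1 :=
  tperm (widen_ord (leqnSn r) i) (lift ord0 i).

Lemma simple_refl_mulmx_eps i (j : 'I_r.+1) :
  simple_refl i *m eps r j = eps r (adj_tperm i j).
Proof.
rewrite simple_refl_mulmx sum_cartan_eps -1?ltnS //.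
rewrite -weight_of_simple_vec raddfB /= !weight_of_evec // 1?ltnW // /adj_tperm.
case: tpermP => [->|->|/eqP neq_ji /eqP neq_ji1].
- by rewrite lift0 eqxx ltn_eqF ?leqnn //= subr0 scale1r subKr.
- by rewrite lift0 eqxx gtn_eqF // sub0r scaleN1r opprK addrC subrK.
move: neq_ji neq_ji1; rewrite -!val_eqE /= => /negPf -> /negPf ->.
by rewrite subrr scale0r subr0.
Qed.

Lemma simple_refl_weight_of i v :
  simple_refl i *m weight_of v = weight_of (row_perm (adj_tperm i) v).
Proof.
rewrite /weight_of mulmx_sumr [RHS](reindex_inj (@perm_inj _ (adj_tperm i))).
apply: eq_bigr => j _; rewrite -scalemxAr simple_refl_mulmx_eps mxE.
by rewrite /adj_tperm tpermK.
Qed.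

Lemma gen_adj_tperm : <<[set adj_tperm i | i : 'I_r]>>%g = [set: 'S_r.+1].
Proof.
apply/eqP; rewrite finset.eqEsubset finset.subsetT /=.
rewrite -(gen_tperm ord0) gen_subG.
apply/fintype.subsetP => _ /imsetP[[y lt_yr] _ ->].
elim: y => [|y IHy] in lt_yr *.
  by rewrite (_ : Ordinal lt_yr = ord0) ?tperm1 ?group1 //; apply: val_inj.
pose i : 'I_r := Ordinal (lt_yr : (y < r)%N).
have adj_i : adj_tperm i = tperm (Ordinal (ltnW lt_yr)) (Ordinal lt_yr).
  by congr tperm; apply: val_inj.
have gen_i : adj_tperm i \in <<[set adj_tperm i | i : 'I_r]>>%g.
  by rewrite mem_gen // imset_f.
have [y0|y_gt0] := posnP y.
  have <- : adj_tperm i = tperm ord0 (Ordinal lt_yr); last by [].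
  by rewrite adj_i; congr tperm; apply: val_inj.
have <- : (tperm ord0 (Ordinal (ltnW lt_yr)) ^ adj_tperm i)%g =
    tperm ord0 (Ordinal lt_yr).
  by rewrite tpermJ adj_i tpermL tpermD // -val_eqE /=; lia.
by rewrite groupJ.
Qed.

Definition word_perm w : 'S_r.+1 := (\prod_(i <- w) adj_tperm i)%g.

Lemma word_perm_surj s : exists w, word_perm w = s.
Proof.
have: s \in [set: 'S_r.+1] by rewrite finset.in_setT.
rewrite -gen_adj_tperm => /gen_prodgP[n [c adj_c ->]].
apply: (big_ind (fun s => exists w, word_perm w = s)).
- by exists [::]; rewrite /word_perm big_nil.
- by move=> _ _ [u <-] [w <-]; exists (u ++ w); rewrite /word_perm big_cat.
move=> k _; have /imsetP[i _ ->] := adj_c k.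
by exists [:: i]; rewrite /word_perm big_seq1.
Qed.

Lemma odd_word_perm w : odd_perm (word_perm w) = odd (size w).
Proof.
rewrite /word_perm; elim: w => [|i w IHw]; first by rewrite big_nil odd_perm1.
by rewrite big_cons odd_mul_tperm IHw -val_eqE /= neq_ltn ltnSn.
Qed.

Lemma word_mx_weight_of w v :
  word_mx w *m weight_of v = weight_of (row_perm (word_perm w) v).
Proof.
rewrite /word_mx /word_perm; elim: w v => [|i w IHw] v.
  by rewrite !big_nil mul1mx row_perm1.
by rewrite !big_cons -mulmxA IHw simple_refl_weight_of row_permM.
Qed.

Definition weyl_mx s : 'M[rat]_r :=
  \matrix_(k, j) weight_of (row_perm s (simple_vec j)) k 0.

Lemma weyl_mx_word w : weyl_mx (word_perm w) = word_mx w.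
Proof.
apply/matrixP => k j; rewrite mxE -word_mx_weight_of weight_of_simple_vec.
by rewrite -colE mxE.
Qed.

Lemma weyl_mx_weight_of s v :
  weyl_mx s *m weight_of v = weight_of (row_perm s v).
Proof.
by have [w <-] := word_perm_surj s; rewrite weyl_mx_word word_mx_weight_of.
Qed.

Lemma weyl_mx_inj : injective weyl_mx.
Proof.
move=> s t eq_st; apply/permP => i.
have: row_perm s (perm_vec 1) = row_perm t (perm_vec 1).
  apply: weight_of_inj; first by rewrite !coord_sum_row_perm.
  by rewrite -!weyl_mx_weight_of eq_st.
by move/colP/(_ i); rewrite !mxE !perm1 => -[/val_inj].
Qed.

Lemma weylE : weyl (r := r) = [set weyl_mx s | s in [set: 'S_r.+1]]%classic.
Proof.
apply/seteqP; split=> [_ [w _ <-]|_ [s _ <-]] /=.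
  by exists (word_perm w) => //; exact: weyl_mx_word.
by have [w <-] := word_perm_surj s; exists w => //; rewrite weyl_mx_word.
Qed.

Lemma sign_len_weyl_mx (R : pzRingType) s :
  (-1) ^+ len (weyl_mx s) = (-1) ^+ s :> R.
Proof.
rewrite /len; case: pselect => [has_w|[]]; last first.
  have [w <-] := word_perm_surj s; exists (size w); apply/existsP.
  by exists (in_tuple w); rewrite weyl_mx_word.
case: ex_minnP => n /existsP[w /eqP word_w] _.
rewrite -signr_odd -{1}(size_tuple w) -odd_word_perm.
congr ((-1) ^+ nat_of_bool (odd_perm _)).
by apply: weyl_mx_inj; rewrite weyl_mx_word.
Qed.

Lemma mult_q_perm (lambda mu : weight r) :
  mult_q lambda mu = \sum_(s : 'S_r.+1) (-1) ^+ s *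
    kostant_q (weyl_mx s *m (lambda + rho r) - (mu + rho r)).
Proof.
rewrite /mult_q weylE fsbig_image; last by move=> s t _ _ /weyl_mx_inj.
rewrite (@fsbig_fwiden _ _ _ _ (index_enum 'S_r.+1)) ?index_enum_uniq //.
- by apply: eq_bigr => s _; rewrite sign_len_weyl_mx.
- by move=> s _ /=; rewrite mem_index_enum.
- by move=> s [_]; case.
Qed.

End WeylGroup.

(** * Kostant's partition function *)

Section Kostant.
Variable r : nat.
Implicit Types xi : weight r.

Lemma root_weightE (b : pos_root r) k :
  root_weight b k 0 = ((val b).1 <= k <= (val b).2)%N%:R.
Proof.
rewrite /root_weight; under eq_bigr do rewrite -[alpha _]scale1r.
by rewrite sum_scale_alphaE; case: ifP.
Qed.

Definition height xi : rat := \sum_k xi k 0.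

Lemma height_is_zmod_morphism : zmod_morphism height.
Proof. by move=> x y; rewrite -sumrB; apply: eq_bigr => k _; rewrite !mxE. Qed.

HB.instance Definition _ :=
  GRing.isZmodMorphism.Build (weight r) rat height height_is_zmod_morphism.

Lemma height_root_weight_ge1 (b : pos_root r) : 1 <= height (root_weight b).
Proof.
rewrite /height (bigD1 (val b).1) //= root_weightE leqnn (valP b) lerDl.
by apply: sumr_ge0 => k _; rewrite root_weightE ler0n.
Qed.

Lemma size_partition_le_height (f : pos_root r -> nat) :
  (\sum_b f b)%N%:R <= height (\sum_b root_weight b *+ f b).
Proof.
rewrite natr_sum [height _]raddf_sum; apply: ler_sum => b _.
by rewrite raddfMn; apply/ler_wMn2r/height_root_weight_ge1.
Qed.

Definition height_bound xi : nat := Num.bound (height xi).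

Lemma size_partition_lt_height_bound (f : pos_root r -> nat) :
  (\sum_b f b < height_bound (\sum_b root_weight b *+ f b)%R)%N.
Proof.
rewrite -(ltr_nat rat); apply: le_lt_trans (size_partition_le_height f) _.
by apply/archi_boundP/(le_trans _ (size_partition_le_height f))/ler0n.
Qed.

Lemma npartitions_widen xi n M : (n < M)%N -> npartitions xi n =
  #|[pred f : {ffun pos_root r -> 'I_M} |
      ((\sum_b (f b : nat))%N == n)
      && (\sum_b root_weight b *+ (f b : nat) == xi)]|.
Proof.
move=> lt_nM.
pose widen (f : {ffun pos_root r -> 'I_n.+1}) :=
  [ffun b => widen_ord lt_nM (f b)].
have widen_inj : injective widen.
  move=> f g /ffunP eq_fg; apply/ffunP => b; apply: val_inj.
  by have /(congr1 val) := eq_fg b; rewrite !ffunE.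
have sum_widen f : (\sum_b (widen f b : nat) = \sum_b f b)%N.
  by apply: eq_bigr => b _; rewrite ffunE.
have weight_widen f :
    \sum_b root_weight b *+ widen f b = \sum_b root_weight b *+ f b.
  by apply: eq_bigr => b _; rewrite ffunE.
rewrite /npartitions -(card_image widen_inj); apply: eq_card => g.
apply/fintype.imageP/idP => [[f f_xi ->]|/andP[/= g_n g_xi]].
  by move: f_xi; rewrite !inE sum_widen weight_widen.
have lt_gn b : (g b < n.+1)%N.
  by rewrite ltnS -(eqP g_n) (bigD1 b) //= leq_addr.
pose f := [ffun b => Ordinal (lt_gn b)].
have gE : g = widen f by apply/ffunP => b; apply: val_inj; rewrite !ffunE.
exists f => //; move: g_n g_xi.
by rewrite gE inE /= sum_widen weight_widen => -> ->.
Qed.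

Lemma kostant_q_bounded xi M : (height_bound xi <= M)%N ->
  kostant_q xi = \sum_(f : {ffun pos_root r -> 'I_M})
    (\sum_b root_weight b *+ f b == xi)%R%:R * 'X^(\sum_b f b).
Proof.
move=> le_xi_M.
have npartitions0 n : (M <= n)%N -> npartitions xi n = 0%N.
  move=> le_Mn; apply: eq_card0 => f; rewrite inE.
  apply/negP => /andP[/eqP f_n /eqP f_xi].
  have := size_partition_lt_height_bound (fun b => f b).
  by rewrite f_xi f_n; lia.
rewrite /kostant_q (@fsbigE _ _ _ _ _ (iota 0 M)) ?iota_uniq //; last first.
  move=> n _; rewrite mem_iota add0n /= -leqNgt => /npartitions0 ->.
  by rewrite scale0r.
pose term n : {poly int} := (npartitions xi n)%:Z *: 'X^n.
transitivity (\sum_(n < M) term n).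
  rewrite -(big_mkord xpredT term) /index_iota subn0.
  by apply: eq_bigl => n; rewrite in_setT.
under eq_bigr => n _ do rewrite /term (npartitions_widen xi (ltn_ord n))
  -sum1_card -natz natr_sum scaler_suml big_mkcond.
rewrite exchange_big /=; apply: eq_bigr => f _.
case: eqP => [f_xi|/eqP/negPf f_xi]; last first.
  by rewrite mul0r big1 // => n _; rewrite inE f_xi andbF.
have lt_fM : (\sum_b (f b : nat) < M)%N.
  by rewrite (leq_trans (size_partition_lt_height_bound _)) ?f_xi.
rewrite (@big_only1 _ _ _ _ (Ordinal lt_fM)) //= => [|n].
  by rewrite inE f_xi !eqxx scale1r mul1r.
by rewrite inE -val_eqE eq_sym /= => /negPf ->.
Qed.

End Kostant.

(** * Multiplicities in one-row representations *)

Section KostantSeries.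
Variables (A : comNzRingType) (q : A) (M r : nat).

Definition kostant_series : {mpoly A[r]} :=
  \prod_(b : pos_root r) \sum_(k < M) q ^+ k *: 'X_[pos_root_mnm b *+ k].

Lemma shift_eval_kostant_series (f : 'cV[int]_r.+1 -> A) v :
  shift_eval simple_vec f v kostant_series =
  \sum_(g : {ffun pos_root r -> 'I_M})
    q ^+ (\sum_b g b) * f (v + \sum_b root_vec b *+ g b).
Proof.
rewrite /kostant_series bigA_distr_bigA raddf_sum; apply: eq_bigr => g _ /=.
rewrite scaler_prod -expr_sum mprodXE linearZ_LR /= shift_evalX.
rewrite mnm_comb_sum; congr (_ * f (_ + _)).
by apply: eq_bigr => b _; rewrite mnm_combMn mnm_comb_pos_root.
Qed.

Lemma kostant_series_weyl_denominator :
  kostant_series * weyl_denominator r A =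
  \prod_(b : pos_root r) truncated_ratio q M (pos_root_mnm b).
Proof. by rewrite mulrC -big_split. Qed.

End KostantSeries.

Section RowMultiplicity.
Variable r : nat.
Implicit Types u lambda mu : 'cV[int]_r.+1.

Lemma kostant_q_weight_of u M :
    coord_sum u = 0 -> (height_bound (weight_of u) <= M)%N ->
  kostant_q (weight_of u) = \sum_(g : {ffun pos_root r -> 'I_M})
    'X^(\sum_b g b) * (\sum_b root_vec b *+ g b == u)%:R.
Proof.
move=> sum_u /kostant_q_bounded ->; apply: eq_bigr => g _; rewrite mulrC.
congr (_ * (nat_of_bool _)%:R).
have <- : weight_of (\sum_b root_vec b *+ g b) = \sum_b root_weight b *+ g b.
  rewrite raddf_sum; apply: eq_bigr => b _.
  by rewrite raddfMn /= weight_of_root_vec.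
apply/eqP/eqP => [|->] //; apply: weight_of_inj.
rewrite sum_u raddf_sum big1 // => b _.
by rewrite -mnm_comb_pos_root raddfMn /= coord_sum_mnm_comb mul0rn.
Qed.

Lemma mult_q_kostant_series lambda mu : coord_sum lambda = coord_sum mu ->
  exists M0, forall M, (M0 <= M)%N ->
  mult_q (weight_of lambda) (weight_of mu) =
  shift_eval simple_vec (alternant {poly int} (lambda + rho_vec r))
    (mu + rho_vec r) (kostant_series 'X M r).
Proof.
move=> sum_lambda.
pose u (s : 'S_r.+1) := row_perm s (lambda + rho_vec r) - (mu + rho_vec r).
exists (\max_s height_bound (weight_of (u s))) => M le_M.
rewrite mult_q_perm shift_eval_kostant_series.
under [RHS]eq_bigr do rewrite mulr_sumr; rewrite [RHS]exchange_big.
apply: eq_bigr => s _ /=.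
rewrite -weight_of_rho_vec -!raddfD weyl_mx_weight_of -raddfB /=.
rewrite (@kostant_q_weight_of _ M).
- rewrite mulr_sumr; apply: eq_bigr => g _; rewrite mulrCA.
  congr (_ * (_ * (nat_of_bool _)%:R)).
  by rewrite [LHS]eq_sym subr_eq [LHS]eq_sym addrC.
- apply/eqP; rewrite raddfB /= coord_sum_row_perm subr_eq0.
  by rewrite !raddfD /= sum_lambda.
- by apply: leq_trans le_M; apply: leq_bigmax.
Qed.

Lemma wdeg_sum_fund_vec (m : 'I_r -> nat) :
  wdeg id (\sum_(i < r) fund_vec r i *+ m i) =
  (\sum_(i < r) m i * 'C(i.+1, 2))%N.
Proof.
rewrite /wdeg.
under eq_bigr do rewrite sum_fund_vecE /= big_distrr /= big_mkcond.
rewrite exchange_big /=; apply: eq_bigr => i _.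
rewrite -big_mkcond (eq_bigl (fun j : 'I_r.+1 => (j < i.+1)%N)) //=.
rewrite -(big_ord_widen r.+1 (fun j => j * m i)%N) ?leqW //.
by rewrite -big_distrl mulnC -(big_mkord xpredT id) -bin2_sum.
Qed.

Theorem mult_q_row (hr : (0 < r)%N) l (m : 'I_r -> nat) :
  l = (\sum_(i < r) i.+1 * m i)%N ->
  mult_q (fund_weight (Ordinal hr) *+ l) (\sum_(i < r) fund_weight i *+ m i) =
  'X^(\sum_(i < r) m i * 'C(i.+1, 2)).
Proof.
move=> def_l; pose mu : 'cV[int]_r.+1 := \sum_(i < r) fund_vec r i *+ m i.
have sum_mu : coord_sum mu = l%:Z by rewrite coord_sum_sum_fund_vec def_l.
have mu_ge0 : nneg_vec mu by apply/forallP => j; rewrite sum_fund_vecE.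
have sum_lambda : coord_sum (fund_vec r 0 *+ l) = coord_sum mu.
  by rewrite sum_mu raddfMn /= coord_sum_fund_vec // natz.
have -> : fund_weight (Ordinal hr) *+ l = weight_of (fund_vec r 0 *+ l).
  by rewrite raddfMn /= -weight_of_fund_vec.
have -> : \sum_(i < r) fund_weight i *+ m i = weight_of mu.
  rewrite raddf_sum; apply: eq_bigr => i _.
  by rewrite raddfMn /= weight_of_fund_vec.
have [M0 mult_qE] := mult_q_kostant_series sum_lambda.
pose M := maxn M0 l.+1; rewrite (mult_qE M) ?leq_maxl //.
have mu_lt_M : coord_sum mu < M%:Z by rewrite sum_mu ltz_nat leq_maxr.
rewrite -wdeg_sum_fund_vec -(shift_eval_prod_truncated_ratio _ mu_ge0 mu_lt_M).
rewrite -kostant_series_weyl_denominator shift_evalM; apply: eq_shift_eval => x.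
rewrite -/(row_rho_vec r l) alternant_row; first by rewrite addrAC addrK.
by rewrite !raddfD /= coord_sum_mnm_comb addr0 sum_lambda.
Qed.

End RowMultiplicity.

Lemma entry_ord r (m : 'I_r -> nat) (i : 'I_r) : entry m i.+1 = m i.
Proof. by rewrite /entry (eq_bigl (pred1 i)) ?big_pred1_eq. Qed.

Lemma sum_entry r (m : 'I_r -> nat) (F : nat -> nat) b :
    (forall j : nat, (b <= j <= r)%N -> entry m j = 0%N) ->
  (\sum_(i < r) m i * F i.+1 = \sum_(k < b) entry m k * F k)%N.
Proof.
move=> entry0; under [RHS]eq_bigr do rewrite /entry big_distrl.
rewrite [RHS](exchange_big_dep predT) //=; apply: eq_bigr => i _.
under eq_bigl do rewrite eq_sym.
rewrite (big_ord1_eq _ (fun k => m i * F k)%N); case: ltnP => // le_bi.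
by rewrite -entry_ord entry0 // le_bi ltn_ord.
Qed.

Theorem theorem1p4 (r : nat) (hr : (0 < r)%N) (l : nat) (m : 'I_r -> nat)
    (hl : l = (\sum_(i < r) i.+1 * m i)%N) :
  let lambda : weight r := fund_weight (Ordinal hr) *+ l in
  let mu : weight r := \sum_(i < r) fund_weight i *+ m i in
  [/\ (forall j : nat, (3 <= j <= r)%N -> entry m j = 0%N) ->
        mult_q lambda mu = 'X^(entry m 2),
      (forall j : nat, (4 <= j <= r)%N -> entry m j = 0%N) ->
        entry m 3 <> 0%N ->
        mult_q lambda mu = 'X^(entry m 2 + 3 * entry m 3)
    & (forall j : nat, (5 <= j <= r)%N -> entry m j = 0%N) ->
        entry m 4 <> 0%N ->
        (entry m 4 = 1%N ->
           mult_q lambda mu = 'X^(entry m 2 + 3 * entry m 3 + 6)) /\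
        ((2 <= entry m 4)%N ->
           mult_q lambda mu =
             'X^(entry m 2 + 3 * entry m 3 + 6 * entry m 4))].
Proof.
move=> lambda mu; rewrite /lambda /mu mult_q_row //.
split=> [entry0|entry0 _|entry0 _]; rewrite (sum_entry (binomial^~ 2) entry0);
  rewrite !big_ord_recr big_ord0 !bin2 /=.
- by congr ('X^_); lia.
- by congr ('X^_); lia.
- by split=> [->|_]; congr ('X^_); lia.
Qed.
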